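(* Let $\mathcal{K}$ be a discrete valued field with valuation $\nu:\mathcal{K}\to\mathbb{Z}$, maximal ideal $\mathfrak{m}$ and finite residue field $\mathbb{F}_q$, let $n\ge 1$ and let $2\leq \ell\leq k$. \begin{enumerate} \item Suppose that $\ell-1$ divides $k-1$. Then the $(k,\ell)$-weakly orthogonal subsets of $\mathbb{B}_n$ of maximum size (i.e. of size $\Delta_n^{(k,\ell)}$) are exactly the sets $\mathcal{F}\subset\mathbb{B}_n$ such that $|\mathcal{F}\cap(\rho_n\circ\gamma_n)^{-1}(\mathbf{v})|=\frac{k-1}{\ell-1}$ for all $\mathbf{v}\in\mathbb{P}^{n-1}(\mathbb{F}_q)$. \item Suppose that $\frac{q^{\ell-1}-1}{q-1}$ divides $k-1$. Then the $(k,\ell)$-orthogonal subsets of $\mathbb{B}_n$ of maximum size (i.e. of size $\Theta_n^{(k,\ell)}$) are exactly the sets $\mathcal{F}\subset\mathbb{B}_n$ such that $|\mathcal{F}\cap(\rho_n\circ\gamma_n)^{-1}(\mathbf{v})|=\frac{(k-1)(q-1)}{q^{\ell-1}-1}$ for all $\mathbf{v}\in\mathbb{P}^{n-1}(\mathbb{F}_q)$. \end{enumerate}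
   Context: The absolute value on $\mathcal{K}$ is $|\lambda|=q^{-\nu(\lambda)}$, and $\mathcal{K}^n$ carries the norm $\Vert \mathbf{v}\Vert=\max_i|v_i|$. Let $\mathbb{B}_n=\{\mathbf{v}\in\mathcal{K}^n:\Vert\mathbf{v}\Vert=1\}$. $\gamma_n:\mathbb{B}_n\to\mathbb{F}_q^n\setminus\{\mathbf 0\}$ is coordinatewise reduction modulo $\mathfrak{m}$ (entries of vectors in $\mathbb{B}_n$ lie in the valuation ring), and $\rho_n:\mathbb{F}_q^n\setminus\{\mathbf 0\}\to\mathbb{P}^{n-1}(\mathbb{F}_q)$ is the canonical projection. Nonzero vectors $\mathbf{u}_1,\dots,\mathbf{u}_\ell\in\mathcal{K}^n$ are orthogonal if $\Vert\sum_i\lambda_i\mathbf{u}_i\Vert=\max_i\Vert\lambda_i\mathbf{u}_i\Vert$ for all $\lambda_i\in\mathcal{K}$; they are weakly orthogonal if pairwise orthogonal. A set $S\subseteq\mathcal{K}^n\setminus\{\mathbf 0\}$ is $(k,\ell)$-orthogonal (resp. $(k,\ell)$-weakly orthogonal) if every $E\subseteq S$ with $|E|=k$ contains an orthogonal (resp. weakly orthogonal) subset of size $\ell$. $\Theta_n^{(k,\ell)}$ (resp. $\Delta_n^{(k,\ell)}$) denotes the maximum size of a $(k,\ell)$-orthogonal (resp. weakly orthogonal) subset of $\mathbb{B}_n$.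
   Formalization: Part 1 is stated for ℓ ≤ max(2, |P^{n-1}(F_q)|) and part 2 for ℓ ≤ max(2, n); for larger ℓ no (weakly) orthogonal ℓ-subset of B_n exists, the maximum size is k−1, and the claimed description is false (e.g. n=1, ℓ=k=3 in part 1). *)

(* Defs.v *)
From mathcomp Require Import all_boot all_order all_algebra finmap.
From mathcomp Require Import boolp classical_sets functions cardinality.

Set Implicit Arguments.
Unset Strict Implicit.
Unset Printing Implicit Defensive.

Import Order.TTheory GRing.Theory Num.Theory.

Local Open Scope classical_set_scope.
Local Open Scope card_scope.
Local Open Scope ring_scope.

(* A discrete valuation on K is given by its values on nonzero elements: the
   convention nu 0 = +oo is replaced by case distinctions below, and the integer
   nu 0 is never used. The value group may be any nonzero subgroup of Z,
   so that nu need not be normalized. *)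
Record discrete_valuation (K : fieldType) (nu : K -> int) : Prop := {
  dvalM : forall x y, x != 0 -> y != 0 -> nu (x * y) = nu x + nu y;
  dvalD : forall x y, x != 0 -> y != 0 -> x + y != 0 ->
    Num.min (nu x) (nu y) <= nu (x + y);
  dval_nontrivial : exists2 x, x != 0 & nu x != 0 }.

Definition valuation_ring (K : fieldType) (nu : K -> int) : {pred K} :=
  [pred x | (x == 0) || (0 <= nu x)].

Definition maximal_ideal (K : fieldType) (nu : K -> int) : {pred K} :=
  [pred x | (x == 0) || (0 < nu x)].

(* red restricts to a surjective ring morphism from the valuation ring onto F
   with kernel the maximal ideal, i.e. it identifies F with the residue field;
   its values outside the valuation ring are arbitrary. *)
Record residue_map (K : fieldType) (nu : K -> int) (F : fieldType)
    (red : K -> F) : Prop := {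
  residue1 : red 1 = 1;
  residueD : {in valuation_ring nu &, {morph red : x y / x + y}};
  residueM : {in valuation_ring nu &, {morph red : x y / x * y}};
  residue_surj : forall a, exists2 x, x \in valuation_ring nu & red x = a;
  residue_ker : {in valuation_ring nu,
    forall x, (red x == 0) = (x \in maximal_ideal nu)} }.

Section Norm.
Variables (K : fieldType) (nu : K -> int) (q : nat).

Definition absv (x : K) : rat := if x == 0 then 0 else q%:R ^ (- nu x).

Definition vnorm n (v : 'rV[K]_n) : rat := \big[Num.max/0]_(i < n) absv (v 0 i).

Definition unit_sphere n : set 'rV[K]_n := [set v | vnorm v = 1].

Definition orthogonal n (T : {fset 'rV[K]_n}) : Prop :=
  (forall u, u \in T -> u != 0) /\
  forall lambda : 'rV[K]_n -> K,
    vnorm (\sum_(u <- T) lambda u *: u)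
      = \big[Num.max/0]_(u <- T) vnorm (lambda u *: u).

Definition weakly_orthogonal n (T : {fset 'rV[K]_n}) : Prop :=
  (forall u, u \in T -> u != 0) /\
  forall u v, u \in T -> v \in T -> u != v -> orthogonal [fset u; v]%fset.

Definition kl_orthogonal n (k l : nat) (S : set 'rV[K]_n) : Prop :=
  S `<=` [set u | u != 0] /\
  forall E : {fset 'rV[K]_n}, [set` E] `<=` S -> #|` E| = k ->
    exists T : {fset 'rV[K]_n},
      [/\ (T `<=` E)%fset, #|` T| = l & orthogonal T].

Definition kl_weakly_orthogonal n (k l : nat) (S : set 'rV[K]_n) : Prop :=
  S `<=` [set u | u != 0] /\
  forall E : {fset 'rV[K]_n}, [set` E] `<=` S -> #|` E| = k ->
    exists T : {fset 'rV[K]_n},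
      [/\ (T `<=` E)%fset, #|` T| = l & weakly_orthogonal T].

End Norm.

(* The projective class of a nonzero vector is its orbit under the units of F,
   and P^(n-1)(F) is the set of these orbits. *)
Definition proj_class (F : finFieldType) n (w : 'rV[F]_n) : {set 'rV[F]_n} :=
  [set c *: w | c : F & c != 0]%SET.

Definition proj_space (F : finFieldType) n : {set {set 'rV[F]_n}} :=
  [set proj_class w | w : 'rV[F]_n & w != 0]%SET.

Definition sphere_fiber (K : fieldType) (nu : K -> int) (F : finFieldType)
    (red : K -> F) n (p : {set 'rV[F]_n}) : set 'rV[K]_n :=
  [set v | unit_sphere nu #|F| v /\ proj_class (map_mx red v) = p].

Definition is_max_size (T : Type) (P : set T -> Prop) (d : nat) : Prop :=
  (exists S, P S /\ S #= `I_d) /\ (forall S, P S -> S #<= `I_d).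

(* Main.v *)
(** Vectors of the unit sphere are orthogonal exactly when their reductions
    are linearly independent over F, so a set is (k, l)-orthogonal when every
    subspace of dimension l - 1 contains fewer than k of the reductions, and
    (k, l)-weakly orthogonal when every l - 1 projective points carry fewer
    than k elements. Averaging these bounds, over the points deleted from a set
    or the hyperplanes of a subspace, raises the dimension up to the whole
    space and gives the maximal size. Equality there forces equality at all
    complements of points (hyperplanes); summing over the hyperplanes through a
    given point then isolates its fiber and shows that all fibers have the same
    size. *)

Require Import Defs.
From mathcomp Require Import all_boot all_order all_algebra finmap.
From mathcomp Require Import boolp classical_sets functions cardinality.
From mathcomp Require Import mxabelem zify ring.

Local Open Scope classical_set_scope.
Local Open Scope card_scope.

(** * Reduction of the unit sphere and orthogonality *)

Section UnitSphere.
Set Implicit Arguments.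
Unset Strict Implicit.
Import Order.TTheory GRing.Theory Num.Theory.
Local Open Scope ring_scope.
Context {K : fieldType} {nu : K -> int} {F : finFieldType} {red : K -> F}.
Hypotheses (hnu : discrete_valuation nu) (hred : residue_map nu red).
Local Notation abs := (absv nu #|F|).
Local Notation norm := (vnorm nu #|F|).
Local Notation O := (valuation_ring nu).
Local Notation r := (map_mx red).

Lemma dval1 : nu 1 = 0.
Proof.
have := dvalM hnu (oner_neq0 K) (oner_neq0 K).
rewrite mulr1 => /eqP.
by rewrite -subr_eq0 opprD addrA subrr sub0r oppr_eq0 => /eqP.
Qed.

Lemma absvM x y : abs (x * y) = abs x * abs y.
Proof.
rewrite /absv mulf_eq0; case: eqVneq => [|x0] /=; first by rewrite mul0r.
case: eqVneq => [|y0] /=; first by rewrite mulr0.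
rewrite (dvalM hnu) // opprD expfzDr // pnatr_eq0.
by have := card_finNzRing_gt1 F; case: #|F|.
Qed.

Lemma absv_le1 x : (abs x <= 1) = (x \in O).
Proof.
rewrite inE /absv; case: eqVneq => //= _.
rewrite -[leRHS](expr0z #|F|%:R) ler_eXz2l ?ltr1n ?card_finNzRing_gt1 //.
by rewrite oppr_le0.
Qed.

Lemma absv_lt1 x : (abs x < 1) = (x \in maximal_ideal nu).
Proof.
rewrite inE /absv; case: eqVneq => //= _.
rewrite -[ltRHS](expr0z #|F|%:R) ltr_eXz2l ?ltr1n ?card_finNzRing_gt1 //.
by rewrite oppr_lt0.
Qed.

Lemma absv_eq0 x : (abs x == 0) = (x == 0).
Proof.
rewrite /absv; case: (eqVneq x 0) => [_|x0]; first exact: eqxx.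
rewrite expfz_eq0 pnatr_eq0 andbC; have := card_finNzRing_gt1 F.
by case: #|F|.
Qed.

Lemma absv_ge0 x : 0 <= abs x.
Proof. by rewrite /absv; case: eqVneq => // _; rewrite exprz_ge0. Qed.

Lemma absv1 : abs 1 = 1.
Proof. by rewrite /absv oner_eq0 dval1 oppr0. Qed.

Lemma val_ring0 : 0 \in O.
Proof. by rewrite inE eqxx. Qed.

Lemma val_ringD x y : x \in O -> y \in O -> x + y \in O.
Proof.
rewrite !inE; have [->|x0] := eqVneq x 0; first by rewrite add0r.
have [->|y0] := eqVneq y 0; first by rewrite addr0 (negPf x0).
have [//|xy0] /= := eqVneq (x + y) 0 => hx hy.
by apply: le_trans (dvalD hnu x0 y0 xy0); rewrite le_min hx.
Qed.

Lemma val_ringM x y : x \in O -> y \in O -> x * y \in O.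
Proof.
rewrite -!absv_le1 absvM => hx hy.
by rewrite mulr_ile1 ?absv_ge0.
Qed.

Lemma red0 : red 0 = 0.
Proof.
have := residueD hred val_ring0 val_ring0; rewrite addr0 => /eqP.
by rewrite -subr_eq0 opprD addrA subrr sub0r oppr_eq0 => /eqP.
Qed.

Lemma red_sum (I : eqType) (s : seq I) (f : I -> K) :
  {in s, forall i, f i \in O} ->
  \sum_(i <- s) f i \in O /\ red (\sum_(i <- s) f i) = \sum_(i <- s) red (f i).
Proof.
elim: s => [|i s IHs] hs; first by rewrite !big_nil red0 val_ring0.
have [|hO hr] := IHs; first by move=> j js; apply: hs; rewrite inE js orbT.
have fi : f i \in O by apply: hs; rewrite mem_head.
by rewrite !big_cons (residueD hred) // hr val_ringD.
Qed.

Section Vectors.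
Context {n : nat}.
Implicit Types (u v : 'rV[K]_n) (T : {fset 'rV[K]_n}).
Local Notation B := (unit_sphere nu #|F| (n:=n)).

(** Norm at most 1 means integral coordinates. Among such vectors, norm below 1 means that all
    coordinates lie in the maximal ideal, the kernel of [red]. *)
Lemma vnorm_sphereP v :
  B v <-> (forall i, v 0 i \in O) /\ r v != 0.
Proof.
have lt_norm : (forall i, v 0 i \in O) -> r v != 0 -> ~~ (norm v < 1).
  move=> vO; apply: contra => /bigmax_ltP [_ h]; apply/eqP/rowP => i.
  rewrite !mxE; apply/eqP; rewrite (residue_ker hred) // -absv_lt1.
  exact: h.
split=> [v1|[vO rv]].
  have vO i : v 0 i \in O by rewrite -absv_le1 -v1 /vnorm; exact: le_bigmax.
  split=> //; apply/eqP => rv0.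
  have: norm v < 1.
    apply: bigmax_lt => // i _; rewrite absv_lt1 -(residue_ker hred) //.
    by have /rowP/(_ i) := rv0; rewrite !mxE => ->.
  by rewrite v1 ltxx.
apply/eqP; rewrite eq_le [1 <= _]leNgt lt_norm // andbT.
by apply: bigmax_le => // i _; rewrite absv_le1.
Qed.

Lemma vnormZ (a : K) v : norm (a *: v) = abs a * norm v.
Proof.
rewrite /vnorm (big_morph ( *%R (abs a)) (id1 := 0) (op1 := Num.max)).
- by apply: eq_bigr => i _; rewrite mxE absvM.
- by move=> x y; rewrite maxr_pMr ?absv_ge0.
- by rewrite mulr0.
Qed.

Lemma vnorm0 : norm (0 : 'rV[K]_n) = 0.
Proof.
by apply: le_anti; rewrite bigmax_ge_id andbT; apply: bigmax_le => // i _;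
  rewrite mxE /absv eqxx.
Qed.

Lemma sphere_neq0 v : B v -> v != 0.
Proof.
by apply: contraPneq => ->; rewrite /unit_sphere /= vnorm0 => /esym/eqP;
  rewrite oner_eq0.
Qed.

(** [red] is a morphism only on the valuation ring, so termwise reduction needs integral
    coefficients. *)
Lemma red_lin_comb T (c : 'rV[K]_n -> K) :
  [set` T] `<=` B -> {in T, forall u, c u \in O} ->
  (forall i, (\sum_(u <- T) c u *: u) 0 i \in O) /\
  r (\sum_(u <- T) c u *: u) = \sum_(u <- T) red (c u) *: r u.
Proof.
move=> TB cO.
have uO u i : u \in T -> u 0 i \in O by move=> /TB/vnorm_sphereP[].
have h i : {in enum_fset T, forall u, c u * u 0 i \in O}.
  by move=> u uT; rewrite val_ringM ?cO ?uO.
have E i : (\sum_(u <- T) c u *: u) 0 i = \sum_(u <- T) c u * u 0 i.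
  by rewrite summxE; apply: eq_bigr => u _; rewrite mxE.
split=> [i|]; first by rewrite E; case: (red_sum (h i)).
apply/rowP => i; rewrite mxE E summxE; have [_ ->] := red_sum (h i).
rewrite !big_seq; apply: eq_bigr => u uT.
by rewrite !mxE (residueM hred) ?cO ?uO.
Qed.

Lemma seq_argmax (I : eqType) (s : seq I) (f : I -> rat) : s != [::] ->
  exists2 i, i \in s & {in s, forall j, f j <= f i}.
Proof.
elim: s => // i [|j s] IHs _.
  by exists i; rewrite ?mem_head // => k; rewrite inE => /eqP->.
have [//|m ms hm] := IHs.
have [mi|im] := leP (f m) (f i).
  exists i; rewrite ?mem_head // => k; rewrite inE => /orP[/eqP->//|/hm] fk.
  exact: le_trans fk mi.
exists m; first by rewrite inE ms orbT.
by move=> k; rewrite inE => /orP[/eqP->|/hm //]; apply: ltW.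
Qed.

(** A nontrivial relation between the reductions lifts to integral coefficients, one of them of
    absolute value 1, whose combination reduces to 0 and so has norm below the maximum 1.
    Conversely, dividing a combination by its coefficient of largest absolute value makes all
    coefficients integral and one equal to 1; by independence its reduction is nonzero, so its norm
    is 1. *)
Lemma orthogonal_redP T : [set` T] `<=` B ->
  Defs.orthogonal nu #|F| T <->
  forall c : 'rV[K]_n -> F, \sum_(u <- T) c u *: r u = 0 ->
    {in T, forall u, c u = 0}.
Proof.
move=> TB; have nT u a : u \in T -> norm (a *: u) = abs a.
  by move=> /TB u1; rewrite vnormZ u1 mulr1.
split=> [[_ oT] c c0 u uT|iT].
  apply/eqP/negPn/negP => cu.
  have [lam lamO red_lam] : exists2 lam : 'rV[K]_n -> K,
      {in T, forall v, lam v \in O} & forall v, red (lam v) = c v.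
    exists (fun v => s2val (cid2 (residue_surj hred (c v)))) => [v _|v];
      by case: cid2.
  have [sO sr] := red_lin_comb TB lamO.
  (* Orthogonality would give this combination the norm 1, because [lam u] has a nonzero
     reduction. *)
  have: ~ B (\sum_(u <- T) lam u *: u).
    move=> /vnorm_sphereP[_]; rewrite sr -{2}c0.
    by under eq_bigr do rewrite red_lam; rewrite eqxx.
  apply; rewrite /unit_sphere /= oT; apply: le_anti; apply/andP; split.
    rewrite big_seq; apply: bigmax_le => // v vT.
    by rewrite nT // absv_le1 lamO.
  apply: (bigmax_sup_seq _ u) => //.
  rewrite nT // leNgt absv_lt1 -(residue_ker hred) ?lamO // red_lam.
  exact: cu.
split=> [u /TB/sphere_neq0//|lam].
have [T0|Tn0] := eqVneq (enum_fset T) [::].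
  by rewrite T0 !big_nil vnorm0.
have [u0 u0T hmax] := seq_argmax (fun u => abs (lam u)) Tn0.
have -> : \big[Num.max/0]_(u <- T) norm (lam u *: u) = abs (lam u0).
  apply: le_anti; apply/andP; split.
    rewrite big_seq; apply: bigmax_le => [|v vT]; first exact: absv_ge0.
    by rewrite nT // hmax.
  by apply: (bigmax_sup_seq _ u0); rewrite ?nT.
have [l0|l0] := eqVneq (lam u0) 0.
  have lam0 : {in T, forall u, lam u = 0}.
    move=> u uT; apply/eqP; rewrite -absv_eq0 eq_le absv_ge0 andbT.
    by rewrite (le_trans (hmax u uT)) // l0 /absv eqxx.
  rewrite big_seq big1 ?vnorm0 ?l0 ?/absv ?eqxx // => u uT.
  by rewrite lam0 // scale0r.
pose mu u := (lam u0)^-1 * lam u.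
have muO : {in T, forall u, mu u \in O}.
  move=> u uT; rewrite -absv_le1 /mu absvM.
  rewrite -(ler_pM2l (x := abs (lam u0))); last first.
    by rewrite lt_neqAle eq_sym absv_eq0 l0 absv_ge0.
  by rewrite mulrA -absvM divff // absv1 mul1r mulr1 hmax.
have -> : \sum_(u <- T) lam u *: u = lam u0 *: \sum_(u <- T) mu u *: u.
  rewrite scaler_sumr; apply: eq_bigr => u _.
  by rewrite scalerA mulrA divff // mul1r.
have [sO sr] := red_lin_comb TB muO.
rewrite vnormZ; suff -> : norm (\sum_(u <- T) mu u *: u) = 1 by rewrite mulr1.
apply/vnorm_sphereP; split=> //; rewrite sr; apply/eqP => /iT/(_ u0 u0T).
by rewrite /mu mulVf // (residue1 hred) => /eqP; rewrite oner_eq0.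
Qed.

End Vectors.
End UnitSphere.

(** * Bounds for sums over subsets of a finite set *)

Section SubsetSums.
Set Implicit Arguments.
Unset Strict Implicit.
Context {T : finType} (D : {set T}) (a : T -> nat) (A d : nat).
Hypotheses (d_gt0 : 0 < d)
  (sum_d : forall X : {set T}, X \subset D -> #|X| = d ->
     \sum_(p in X) a p <= A * d).

(* Averaging over the sets obtained by deleting one point. *)
Lemma sum_subset_le e (X : {set T}) :
  X \subset D -> #|X| = d + e -> \sum_(p in X) a p <= A * (d + e).
Proof.
elim: e X => [|e IHe] X XD cX; first by rewrite addn0 sum_d // cX addn0.
have split_x x : x \in X ->
    \sum_(p in X) a p = a x + \sum_(p in X :\ x) a p by apply: big_setD1.
have : \sum_(x in X) \sum_(p in X) a p <=
    \sum_(x in X) (a x + A * (d + e)).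
  apply: leq_sum => x xX; rewrite (split_x x) // leq_add2l IHe //.
    exact: fintype.subset_trans (subD1set _ _) XD.
  by have := cardsD1 x X; rewrite xX cX addnS add1n => -[].
(* With S the sum over X, this reads (d+e+1) S <= S + (d+e+1) A (d+e); dividing by d+e, positive
   since d is, gives the claim. *)
by rewrite big_split /= !sum_nat_const cX; nia.
Qed.

(** Deleting a point leaves at most A (#|D| - 1), so every value is at least A; the total A #|D|
    then leaves no excess. For d > 1 the strict inequality keeps at least d points after the
    deletion. *)
Lemma sum_subset_eq p :
  d <= #|D| -> (1 < d -> d < #|D|) ->
  \sum_(x in D) a x = A * #|D| -> p \in D -> a p = A.
Proof.
move=> leD ltD sumD; have le_del x : x \in D ->
    \sum_(y in D :\ x) a y <= A * (#|D| - 1) => [xD|].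
  have cD : #|D| = #|D :\ x|.+1 by rewrite (cardsD1 x) xD.
  (* The one-point case d = #|D| = 1 leaves the empty set, which the averaged bound does not
     cover. *)
  have [D1|D_gt1] := posnP #|D :\ x|; first by rewrite (cards0_eq D1) big_set0.
  rewrite (_ : #|D| - 1 = d + (#|D| - 1 - d)); last by lia.
  by apply: sum_subset_le; [exact: subD1set|lia].
have ge_a x : x \in D -> A <= a x.
  move=> xD; have := le_del x xD; move: sumD; rewrite (big_setD1 x) //=.
  by have : 0 < #|D|; [lia|nia].
move=> pD; apply/eqP; rewrite eqn_leq ge_a // andbT.
have : \sum_(y in D :\ p) A <= \sum_(y in D :\ p) a y.
  by apply: leq_sum => y /setD1P[_ /ge_a].
rewrite sum_nat_const; move: sumD; rewrite (big_setD1 p) //= (cardsD1 p) pD.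
by nia.
Qed.

End SubsetSums.

(** * Projective points and functionals over the residue field *)

Section ProjectiveSpace.
Set Implicit Arguments.
Unset Strict Implicit.
Import GRing.Theory.
Context {F : finFieldType} {n : nat}.
Local Notation q := #|F|.
Implicit Types (u v x f : 'rV[F]_n).
Local Open Scope ring_scope.
Local Open Scope nat_scope.

Lemma mem_proj_class u v : v != 0%R ->
  (u \in proj_class v) = (u != 0%R) && (u <= v)%MS.
Proof.
move=> v0; apply/imsetP/andP => [[c]|[u0 /sub_rVP[c uE]]].
  by rewrite inE => c0 ->; rewrite scaler_eq0 negb_or c0 v0 scalemx_sub.
by exists c => //; move: u0; rewrite inE uE scaler_eq0 negb_or => /andP[].
Qed.

Lemma proj_class_refl v : v != 0%R -> v \in proj_class v.
Proof. by move=> v0; rewrite mem_proj_class // v0 submx_refl. Qed.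

Lemma proj_class_eq u v : u != 0%R -> v != 0%R ->
  (proj_class u == proj_class v) = (u \in proj_class v).
Proof.
move=> u0 v0; apply/eqP/idP => [<-|]; first exact: proj_class_refl.
rewrite mem_proj_class // u0 /= => uv.
have vu : (v <= u)%MS.
  have := uv; move=> /sub_rVP[c uE]; apply/sub_rVP; exists (c^-1)%R.
  rewrite uE scalerA mulVf ?scale1r //.
  by apply: contraNneq u0 => c0; rewrite uE c0 scale0r.
apply/setP => x; rewrite !mem_proj_class //.
by congr (_ && _); apply/idP/idP => /submx_trans; apply.
Qed.

Lemma proj_spaceP p :
  reflect (exists2 x : 'rV[F]_n, x != 0%R & p = proj_class x)
    (p \in proj_space F n).
Proof.
by apply: (iffP imsetP) => -[x x0 ->]; exists x => //; move: x0; rewrite inE.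
Qed.

Lemma mem_proj_space x : x != 0%R -> proj_class x \in proj_space F n.
Proof. by move=> x0; apply/proj_spaceP; exists x. Qed.

Lemma card_proj_class v : v != 0%R -> #|proj_class v| = q - 1.
Proof.
move=> v0; rewrite card_in_imset; last first.
  move=> c c' _ _ /eqP; rewrite -subr_eq0 -scalerBl scaler_eq0 (negPf v0) orbF.
  by rewrite subr_eq0 => /eqP.
rewrite subn1 -(cardC1 (0%R : F)); apply: eq_card => c.
by rewrite !inE.
Qed.

Lemma card_proj_space : #|proj_space F n| * (q - 1) = q ^ n - 1.
Proof.
have <- : #|[pred v : 'rV[F]_n | v != 0%R]| = q ^ n - 1.
  by have := cardC1 (0%R : 'rV[F]_n); rewrite card_mx mul1n subn1.
rewrite -[RHS]sum1_card.
rewrite (partition_big (@proj_class F n) (mem (proj_space F n))) /=;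
  last exact: mem_proj_space.
rewrite -sum_nat_const; apply: eq_bigr => p /proj_spaceP[x x0 ->].
rewrite -(card_proj_class x0) -sum1_card; apply: eq_bigl => v.
rewrite mem_proj_class // inE.
have [->|v0] := eqVneq v 0%R; first by [].
by rewrite /= proj_class_eq // mem_proj_class // v0.
Qed.

(** A row [f] encodes the functional sending v to [v *m f^T]; those vanishing on the rows of M form
    the kernel of the transpose of M. *)
Lemma card_annihilator m (M : 'M[F]_(m, n)) :
  #|[set f : 'rV[F]_n | (M *m f^T == 0)%R]%SET| = q ^ (n - \rank M).
Proof.
rewrite -mxrank_tr -mxrank_ker -card_rowg; apply: eq_card => f.
rewrite mem_rowg inE; apply/eqP/sub_kermxP => [|h]; last first.
  by apply: trmx_inj; rewrite trmx_mul trmxK h trmx0.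
by move=> h; apply: trmx_inj; rewrite trmx_mul trmxK h trmx0.
Qed.

Lemma ann_sub m1 m2 (M : 'M[F]_(m1, n)) (W : 'M[F]_(m2, n)) f :
  (M <= W)%MS -> (W *m f^T == 0)%R -> (M *m f^T == 0)%R.
Proof. by case/submxP=> D -> /eqP Wf; rewrite -mulmxA Wf mulmx0. Qed.

Lemma card_annihilatorD m1 m2 (M : 'M[F]_(m1, n)) (W : 'M[F]_(m2, n)) :
  (M <= W)%MS ->
  #|[set f : 'rV[F]_n | (M *m f^T == 0)%R && (W *m f^T != 0)%R]%SET| =
    q ^ (n - \rank M) - q ^ (n - \rank W).
Proof.
move=> MW; rewrite -!card_annihilator -cardsDS.
  by apply: eq_card => f; rewrite !inE andbC.
by apply/fintype.subsetP => f; rewrite !inE; apply: ann_sub.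
Qed.

(** * Weights of subspaces and averaging over hyperplanes *)

Section Mass.
Context {w : 'rV[F]_n -> nat} (w0 : w 0%R = 0).

(** In the application [w v] is the number of elements of a finite set with reduction v, so that
    [mass W] counts the elements whose reduction lies in W. *)
Definition mass m (W : 'M[F]_(m, n)) := \sum_(v | (v <= W)%MS) w v.

Lemma sum_mass_kermx (P : pred 'rV[F]_n) m (W : 'M[F]_(m, n)) :
  \sum_(f | P f) mass (W :&: kermx f^T)%MS =
    \sum_(v | (v <= W)%MS)
      w v * #|[set f : 'rV[F]_n | (v *m f^T == 0)%R && P f]%SET|.
Proof.
under eq_bigr => f _ do rewrite /mass.
rewrite (exchange_big_dep (fun v => (v <= W)%MS)) /=; last first.
  by move=> f v _; rewrite sub_capmx => /andP[].
apply: eq_bigr => v vW; rewrite -sum1_card big_distrr /=.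
apply: eq_big => [f|f _]; last by rewrite muln1.
rewrite sub_capmx vW inE andbC /=; congr (_ && _).
by apply/sub_kermxP/eqP.
Qed.

Lemma rank_cap_kermx m (W : 'M[F]_(m, n)) f : (W *m f^T != 0)%R ->
  \rank (W :&: kermx f^T)%MS = (\rank W).-1.
Proof.
move=> Wf; have := mxrank_mul_ker W f^T.
have : \rank (W *m f^T) <= 1 by apply: rank_leq_col.
by rewrite leq_eqVlt ltnS leqn0 mxrank_eq0 (negPf Wf) orbF => /eqP-> <-.
Qed.

Lemma rank_rVn0 v : v != 0%R -> \rank v = 1.
Proof. by rewrite rank_rV => ->. Qed.

(** Each nonzero v in W is killed by the same number of functionals that do not vanish on W, and the
    zero vector has no weight. *)
Lemma sum_mass_hyperplanes m (W : 'M[F]_(m, n)) :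
  \sum_(f : 'rV[F]_n | (W *m f^T != 0)%R) mass (W :&: kermx f^T)%MS =
    mass W * (q ^ (n - 1) - q ^ (n - \rank W)).
Proof.
rewrite sum_mass_kermx big_distrl /=; apply: eq_bigr => v vW.
have [->|v0] := eqVneq v 0%R; first by rewrite w0.
by rewrite card_annihilatorD // rank_rVn0.
Qed.

Lemma card_nonannihilator m (W : 'M[F]_(m, n)) :
  #|[pred f : 'rV[F]_n | (W *m f^T != 0)%R]| = q ^ n - q ^ (n - \rank W).
Proof.
have := @card_annihilatorD 1 m 0%R W (sub0mx _ _); rewrite mxrank0 subn0 => <-.
by apply: eq_card => f; rewrite !inE mul0mx eqxx.
Qed.

(* Averaging over the hyperplanes ker f of W, for the functionals f that do not
   vanish on W. *)
Lemma mass_le (A d e : nat) (W : 'M[F]_n) : 0 < d ->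
  (forall V : 'M[F]_n, \rank V = d -> mass V * (q - 1) <= A * (q ^ d - 1)) ->
  \rank W = d + e -> mass W * (q - 1) <= A * (q ^ (d + e) - 1).
Proof.
move=> d0 bound_d; elim: e W => [|e IHe] W rW.
  by rewrite addn0 bound_d // rW addn0.
have q1 : 1 < q := card_finNzRing_gt1 F.
have le_n : d + e.+1 <= n by rewrite -rW rank_leq_col.
have : \sum_(f : 'rV[F]_n | (W *m f^T != 0)%R)
         mass (W :&: kermx f^T)%MS * (q - 1) <=
       \sum_(f : 'rV[F]_n | (W *m f^T != 0)%R) A * (q ^ (d + e) - 1).
  apply: leq_sum => f Wf; rewrite IHe // rank_cap_kermx // rW; lia.
rewrite -big_distrl /= sum_mass_hyperplanes sum_nat_const card_nonannihilator rW.
(* Both counts of functionals are multiples of c = q^(n - rank W), the size of the annihilator of W.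
   The common factor c (q^(d+e) - 1) is cancelled at the end; it is positive because d > 0. *)
have -> : q ^ (n - 1) = q ^ (n - (d + e.+1)) * q ^ (d + e).
  by rewrite -expnD; congr (_ ^ _); lia.
have -> : q ^ n = q ^ (n - (d + e.+1)) * q ^ (d + e.+1).
  by rewrite -expnD; congr (_ ^ _); lia.
have c0 : 0 < q ^ (n - (d + e.+1)) by rewrite expn_gt0; lia.
have qe : 1 < q ^ (d + e) by rewrite -(expn0 q) ltn_exp2l //; lia.
move: (q ^ (n - _)) c0 => c c0.
have cB y : c * y - c = c * (y - 1) by rewrite mulnBr muln1.
rewrite !cB => h.
rewrite -(leq_pmul2l (m := c * (q ^ (d + e) - 1))).
  rewrite [leqLHS](_ : _ = mass W * (c * (q ^ (d + e) - 1)) * (q - 1)).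
    apply: leq_trans h _; apply: eq_leq.
    by move: (q ^ (d + e) - 1) (q ^ (d + e.+1) - 1) => y z; ring.
  by move: (q ^ (d + e) - 1) (q - 1) (mass W) => y z t; ring.
by rewrite muln_gt0 c0 subn_gt0.
Qed.

Lemma rank_col_mx_rV x v : x != 0%R -> v != 0%R ->
  \rank (col_mx x v) = if (v <= x)%MS then 1 else 2.
Proof.
move=> x0 v0; rewrite -addsmxE; case: ifPn => [/addsmx_idPl->|vx].
  exact: rank_rVn0.
apply/eqP; rewrite eqn_leq; apply/andP; split.
  by rewrite addsmxE rank_leq_row.
have : (x < x + v)%MS.
  rewrite ltmxE addsmxSl; apply: contra vx; apply: submx_trans.
  exact: addsmxSr.
by rewrite ltmxErank rank_rVn0 // => /andP[].
Qed.

Lemma mass_class_eq (A d : nat) x : 0 < d -> d <= n -> (1 < d -> d < n) ->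
  (forall V : 'M[F]_n, \rank V = d -> mass V * (q - 1) <= A * (q ^ d - 1)) ->
  mass 1%:M * (q - 1) = A * (q ^ n - 1) ->
  x != 0%R -> \sum_(v in proj_class x) w v = A.
Proof.
move=> d0 dn dn1 bound_d tot x0.
have q1 : 1 < q := card_finNzRing_gt1 F.
have classE : \sum_(v in proj_class x) w v = mass x.
  rewrite /mass [RHS](bigD1 0%R) ?sub0mx //= w0 add0n.
  by apply: eq_bigl => v; rewrite mem_proj_class // andbC.
(* In dimension 1 the line of x is the whole space and the total already gives the claim. Otherwise
   hyperplanes have dimension n - 1 >= d, and the averaged bound applies to them. *)
rewrite classE; have [n1|n_gt1] := leqP n 1.
  have n1' : n = 1 by lia.
  have -> : mass x = mass 1%:M.
    apply: eq_bigl => v; rewrite submx1 submx_full //.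
    by rewrite /row_full rank_rVn0 // n1'.
  move: tot; rewrite (_ : q ^ n = q) => [/eqP|]; last by rewrite n1' expn1.
  by rewrite eqn_pmul2r ?subn_gt0 // => /eqP.
have hyp f : (1%:M *m f^T != 0)%R ->
    mass (1%:M :&: kermx f^T)%MS * (q - 1) = A * (q ^ (n - 1) - 1).
  have bnd f' : (1%:M *m f'^T != 0)%R ->
     mass (1%:M :&: kermx f'^T)%MS * (q - 1) <= A * (q ^ (n - 1) - 1).
    move=> f0; rewrite (_ : n - 1 = d + (n - 1 - d)); last by lia.
    by apply: mass_le => //; rewrite rank_cap_kermx // mxrank1; lia.
  (* The sum of the bounds equals the sum of the masses by [tot], so every single bound is
     attained. *)
  have := leqif_sum (fun f' h => leqif_eq (bnd f' h)).
  rewrite -big_distrl /= sum_mass_hyperplanes sum_nat_const.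
  rewrite card_nonannihilator mxrank1 subnn expn0 mulnAC tot.
  rewrite mulnAC mulnC mulnA [_ * A]mulnC -mulnA => -[_].
  rewrite eqxx => /esym/forall_inP/(_ f) h /h /eqP; exact.
(* All hyperplanes attain the bound; those through x count the line of x more
   often than any other line. *)
have : \sum_(f : 'rV[F]_n | (x *m f^T == 0)%R && (1%:M *m f^T != 0)%R)
      mass (1%:M :&: kermx f^T)%MS * (q - 1) =
    (q ^ (n - 1) - 1) * (A * (q ^ (n - 1) - 1)).
  rewrite (eq_bigr _ (fun f h => hyp f (proj2 (andP h)))) sum_nat_const.
  congr (_ * _); have := card_annihilatorD (submx1 x).
  rewrite rank_rVn0 // mxrank1 subnn expn0 => <-.
  by apply: eq_card => f; rewrite !inE.
rewrite -big_distrl /= sum_mass_kermx.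
have -> : \sum_(v | (v <= 1%:M)%MS) w v *
     #|[set f : 'rV[F]_n | (v *m f^T == 0)%R &&
          ((x *m f^T == 0)%R && (1%:M *m f^T != 0)%R)]%SET| =
   \sum_(v | (v <= 1%:M)%MS) (w v * (q ^ (n - 2) - 1) +
      if (v <= x)%MS then w v * (q ^ (n - 1) - q ^ (n - 2)) else 0).
  apply: eq_bigr => v _; have [->|v0] := eqVneq v 0%R.
    by rewrite w0 !mul0n; case: ifP.
  (* Killing x and v means killing their span, of dimension 1 or 2 according to whether v lies on
     the line of x. This leaves q^(n-1) - 1 or q^(n-2) - 1 nonzero functionals. *)
  have <- : #|[set f : 'rV[F]_n |
        (col_mx x v *m f^T == 0)%R && (1%:M *m f^T != 0)%R]%SET| =
     #|[set f : 'rV[F]_n | (v *m f^T == 0)%R &&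
          ((x *m f^T == 0)%R && (1%:M *m f^T != 0)%R)]%SET|.
    apply: eq_card => f; rewrite !inE mul_col_mx col_mx_eq0.
    by rewrite andbA [(v *m _ == _)%R && _]andbC.
  rewrite card_annihilatorD ?submx1 // rank_col_mx_rV // mxrank1 subnn expn0.
  case: ifP => _; last by rewrite addn0.
  rewrite -mulnDr; congr (_ * _).
  have : q ^ (n - 2) <= q ^ (n - 1) by rewrite leq_exp2l //; lia.
  have : 0 < q ^ (n - 2) by rewrite expn_gt0; lia.
  by lia.
rewrite big_split /= -big_distrl -big_mkcondr -big_distrl /=.
rewrite -/(mass 1%:M) (eq_bigl (fun v => (v <= x)%MS)); last first.
  by move=> v; rewrite submx1.
rewrite -/(mass x).
have -> : q ^ (n - 1) = q ^ (n - 2) * q.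
  by rewrite -expnSr; congr (_ ^ _); lia.
move: tot; have -> : q ^ n = q ^ (n - 2) * q * q.
  by rewrite -!expnSr; congr (_ ^ _); lia.
have : 0 < q ^ (n - 2) by rewrite expn_gt0; lia.
move: (q ^ (n - 2)) (mass x) (mass 1%:M) => Q a t Q0.
have -> : Q * q - Q = Q * (q - 1) by rewrite mulnBr muln1.
case: Q Q0 => // Q _; case: #|F| q1 => // s s0.
rewrite !subn1 /= => tot eq2.
(* Here [Q.+1] is q^(n-2) and s = q - 1. Writing R for q^(n-2), elimination of the total mass t
   rests on (R q - 1)^2 - (R q^2 - 1)(R - 1) = R (q - 1)^2. *)
suff: a * Q.+1 * s * s = A * Q.+1 * s * s.
  move/eqP; rewrite !eqn_pmul2r //; first by move/eqP.
nia.
Qed.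

Lemma mass_const (A : nat) m (W : 'M[F]_(m, n)) :
  (forall x : 'rV[F]_n, x != 0%R -> \sum_(v in proj_class x) w v = A) ->
  mass W * (q - 1) = A * (q ^ \rank W - 1).
Proof.
move=> wA; rewrite /mass (bigD1 0%R) ?sub0mx //= w0 add0n big_distrl /=.
(* Each weight [w v] is repeated once for each of the q - 1 vectors u in the class of v; after the
   exchange, every u collects the weight A of its whole class. *)
transitivity (\sum_(v | (v <= W)%MS && (v != 0%R))
    \sum_(u in proj_class v) w v).
  apply: eq_bigr => v /andP[_ v0].
  by rewrite sum_nat_const card_proj_class // mulnC.
rewrite (exchange_big_dep (fun u => (u <= W)%MS && (u != 0%R))) /=; last first.
  move=> v u /andP[vW v0]; rewrite mem_proj_class // => /andP[-> uv].
  by rewrite (submx_trans uv).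
rewrite (eq_bigr (fun=> A)) => [|u /andP[uW u0]]; last first.
  rewrite -(wA u u0); apply: eq_bigl => v.
  have [v0|v0] := eqVneq v 0%R.
    by rewrite v0 (mem_proj_class _ u0) eqxx andbF.
  have -> : (u \in proj_class v) = (v \in proj_class u).
    by rewrite -!proj_class_eq // eq_sym.
  rewrite andbT mem_proj_class // v0 /=.
  by case vu: (v <= u)%MS; rewrite ?andbF // (submx_trans vu).
rewrite sum_nat_const mulnC -card_rowg; congr (_ * _).
rewrite [in RHS](cardD1 (0%R : 'rV_n)) mem_rowg sub0mx add1n subn1 /=.
by apply: eq_card => v; rewrite !inE andbC.
Qed.

End Mass.
End ProjectiveSpace.

(** * Counting elements of finite sets by their images *)

Section Counting.
Set Implicit Arguments.
Unset Strict Implicit.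

Lemma count_fibers (T : Type) (U : finType) (g : T -> U) (P : pred U)
  (s : seq T) :
  count (fun u => P (g u)) s = \sum_(v | P v) count (fun u => g u == v) s.
Proof.
elim: s => [|u s IHs] /=; first by rewrite big1.
rewrite big_split /= IHs; congr (_ + _).
have [Pu|Pu] := boolP (P (g u)).
  rewrite (bigD1 (g u)) //= eqxx big1 // => v /andP[_].
  by rewrite eq_sym => /negPf->.
by rewrite big1 // => v Pv; case: eqP Pu => // ->; rewrite Pv.
Qed.

Lemma exists_subfset (T : choiceType) (E : {fset T}) (P : pred T) k :
  k <= count P E -> exists E' : {fset T},
    [/\ (E' `<=` E)%fset, #|` E'| = k & {in E', forall u, P u}].
Proof.
move=> kP; have uE : uniq (take k (filter P E)).
  by rewrite take_uniq // filter_uniq // fset_uniq.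
have sub : {subset take k (filter P E) <= filter P E} by move=> u /mem_take.
exists [fset u in take k (filter P E)]%fset; split.
- by apply/fsubsetP => u; rewrite !inE => /sub; rewrite mem_filter => /andP[].
- by rewrite card_fseq undup_id // size_takel // size_filter.
- by move=> u; rewrite !inE => /sub; rewrite mem_filter => /andP[].
Qed.

Lemma count_subfset (T : choiceType) (E' E : {fset T}) (P : pred T) :
  (E' `<=` E)%fset -> count P E' <= count P E.
Proof.
move=> /fsubsetP EE; rewrite -!size_filter.
apply: uniq_leq_size; first by rewrite filter_uniq // fset_uniq.
by move=> u; rewrite !mem_filter => /andP[-> /EE].
Qed.

End Counting.

(** * Orthogonality conditions as counts of reductions *)

Section Glue.
Set Implicit Arguments.
Unset Strict Implicit.
Import GRing.Theory.
Context {K : fieldType} {nu : K -> int} {F : finFieldType} {red : K -> F}.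
Hypotheses (hnu : discrete_valuation nu) (hred : residue_map nu red).
Context {n : nat}.
Implicit Types (u v : 'rV[K]_n) (T E : {fset 'rV[K]_n}) (S : set 'rV[K]_n).
Local Notation q := #|F|.
Local Notation B := (unit_sphere nu q (n:=n)).
Local Notation r := (map_mx red).
Local Notation class u := (proj_class (r u : 'rV[F]_n)).

Lemma red_neq0 u : B u -> r u != 0%R.
Proof. by move=> /(vnorm_sphereP hred)[]. Qed.

(** Two nonzero reductions are independent exactly when they span different lines. *)
Lemma orthogonal_pairP u v : B u -> B v -> u != v ->
  Defs.orthogonal nu q [fset u; v]%fset <-> class u != class v.
Proof.
move=> Bu Bv uv; have [u0 v0] := (red_neq0 Bu, red_neq0 Bv).
have sB : [set` [fset u; v]%fset] `<=` B.
  by move=> x /=; rewrite !inE => /orP[] /eqP->.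
have sum2 (c : 'rV[K]_n -> F) :
    (\sum_(x <- [fset u; v]%fset) c x *: r x = c u *: r u + c v *: r v)%R.
  by rewrite big_fsetU1 ?inE //= big_seq_fset1.
rewrite (orthogonal_redP hnu hred sB) proj_class_eq //; split=> [indep|uv' c].
  apply/negP => /imsetP[a _ ruE].
  have := indep (fun x => if x == u then 1 else - a)%R.
  rewrite sum2 eqxx eq_sym (negPf uv) scale1r scaleNr ruE subrr.
  move=> /(_ erefl u); rewrite !inE !eqxx => /(_ isT)/eqP.
  by rewrite oner_eq0.
rewrite sum2 => cE; have cu0 : c u = 0%R.
  apply/eqP; apply: contraNT uv' => cu; rewrite mem_proj_class // u0 /=.
  apply/sub_rVP; exists (- ((c u)^-1 * c v))%R.
  move/eqP: cE; rewrite addr_eq0 => /eqP/(congr1 (fun x => (c u)^-1 *: x)%R).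
  by rewrite scalerA mulVf // scale1r scalerN scalerA scaleNr.
move: cE; rewrite cu0 scale0r add0r => /eqP; rewrite scaler_eq0 (negPf v0) orbF.
by move=> /eqP cv0 x; rewrite !inE => /orP[] /eqP->.
Qed.

Lemma weakly_orthogonalP T : [set` T] `<=` B ->
  weakly_orthogonal nu q T <-> {in T &, injective (fun u => class u)}.
Proof.
move=> TB; split=> [[_ wT] u v uT vT uv|inj].
  apply/eqP/negPn/negP => nuv; have := wT u v uT vT nuv.
  by rewrite (orthogonal_pairP (TB u uT) (TB v vT) nuv) uv eqxx.
split=> [u /TB/sphere_neq0//|u v uT vT uv].
apply/(orthogonal_pairP (TB u uT) (TB v vT) uv).
by apply: contraNneq uv => /inj->.
Qed.

Lemma sub_sphere T E : (T `<=` E)%fset -> [set` E] `<=` B -> [set` T] `<=` B.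
Proof. by move=> /fsubsetP TE EB u /TE/EB. Qed.

(** Otherwise k elements with classes in X would contain l elements with distinct classes, more than
    X has. *)
Lemma kl_weakly_count k l E (X : {set {set 'rV[F]_n}}) : [set` E] `<=` B ->
  kl_weakly_orthogonal nu q k l [set` E] -> #|X| < l ->
  count (fun u => class u \in X) E < k.
Proof.
move=> EB [_ kl] Xl; rewrite ltnNge; apply/negP => /exists_subfset[E' [EE cE PX]].
have E'E : [set` E'] `<=` [set` E] by move=> u /(fsubsetP EE).
have [T [TE cT]] := kl E' E'E cE.
rewrite weakly_orthogonalP; last first.
  exact: sub_sphere (fsubset_trans TE EE) EB.
move=> inj; suff: l <= #|X| by rewrite leqNgt Xl.
rewrite -cT -(size_map (fun u => class u)) cardE; apply: uniq_leq_size.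
  by rewrite map_inj_in_uniq ?fset_uniq.
by move=> _ /mapP[u uT ->]; rewrite mem_enum PX // (fsubsetP TE).
Qed.

(** Fewer than l classes carry at most A (l - 1) = k - 1 elements, so any k elements meet at least l
    classes; one representative of each of l classes is chosen. *)
Lemma kl_weakly_of_const k l A E : [set` E] `<=` B -> 1 < l -> 0 < k ->
  k - 1 = A * (l - 1) ->
  {in proj_space F n, forall p, count (fun u => class u == p) E = A} ->
  kl_weakly_orthogonal nu q k l [set` E].
Proof.
move=> EB l1 k0 kA cA; split=> [u /EB/sphere_neq0//|E' E'E cE'].
have E'E' : (E' `<=` E)%fset by apply/fsubsetP => u /E'E.
have E'B := sub_sphere E'E' EB.
pose X := [set p in [seq class u | u <- E']]%SET.
have XP p : p \in X -> exists2 u, u \in E' & class u == p.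
  by rewrite inE => /mapP[u uE ->]; exists u.
have lX : l <= #|X|.
  rewrite leqNgt; apply/negP => Xl.
  have : k <= count (fun u => class u \in X) E.
    apply: leq_trans (count_subfset _ E'E'); rewrite -cE' -size_filter.
    rewrite (_ : filter _ _ = E') //; apply/all_filterP/allP => u uE /=.
    by rewrite inE (map_f (fun u => class u)).
  rewrite (count_fibers (fun u => class u) (mem X)).
  rewrite (eq_bigr (fun=> A)) => [|p /XP[u /E'B Bu /eqP<-]]; last first.
    by rewrite cA // mem_proj_space // red_neq0.
  rewrite sum_nat_const; nia.
have [s sP] : exists s : {set 'rV[F]_n} -> 'rV[K]_n,
    forall p, p \in X -> s p \in E' /\ class (s p) = p.
  have h p : exists u, p \in X -> u \in E' /\ class u = p.
    have [pX|_] := boolP (p \in X); last by exists 0%R.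
    by have [u uE /eqP] := XP p pX; exists u.
  by exists (fun p => projT1 (cid (h p))) => p pX; case: cid => u /=; apply.
have subX : {subset take l (enum X) <= X}.
  by move=> p /mem_take; rewrite mem_enum.
exists [fset s p | p in take l (enum X)]%fset.
have TE : ([fset s p | p in take l (enum X)] `<=` E')%fset.
  by apply/fsubsetP => _ /imfsetP[p /= /subX/sP[? _] ->].
split=> //.
  rewrite card_in_imfset /=; last first.
    by move=> p p' /subX/sP[_ {2}<-] /subX/sP[_ {2}<-] ->.
  by rewrite undup_id ?take_uniq ?enum_uniq // size_takel // -cardE.
rewrite weakly_orthogonalP; last exact: sub_sphere TE E'B.
move=> _ _ /imfsetP[p /= /subX/sP[_ pE] ->] /imfsetP[p' /= /subX/sP[_ pE'] ->].
by rewrite pE pE' => ->.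
Qed.

(** Otherwise V would contain l independent reductions, more than its rank allows. *)
Lemma kl_orthogonal_count k l E m (V : 'M[F]_(m, n)) : [set` E] `<=` B ->
  kl_orthogonal nu q k l [set` E] -> \rank V < l ->
  count (fun u => (r u <= V)%MS) E < k.
Proof.
move=> EB [_ kl] Vl; rewrite ltnNge; apply/negP => /exists_subfset[E' [EE cE PV]].
have E'E : [set` E'] `<=` [set` E] by move=> u /(fsubsetP EE).
have [T [TE cT]] := kl E' E'E cE.
rewrite (orthogonal_redP hnu hred); last first.
  exact: sub_sphere (fsubset_trans TE EE) EB.
move=> indep; pose M := (\matrix_(i < #|` T|) r (nth 0 (enum_fset T) i))%R.
have MV : (M <= V)%MS.
  apply/row_subP => i; rewrite rowK PV // (fsubsetP TE) //.
  exact: mem_nth.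
have : ~~ row_free M.
  by rewrite /row_free neq_ltn (leq_ltn_trans (mxrankS MV)) // cT.
rewrite -kermx_eq0 => /rowV0Pn[x /sub_kermxP xM x0].
(* The row relation x between the reductions becomes a function on vectors through the position of u
   in T, with value 0 off T. *)
pose c u := (if insub (index u (enum_fset T)) is Some i then x 0 i else 0)%R.
have cT_ (i : 'I_#|` T|) : c (nth 0%R (enum_fset T) i) = x 0%R i.
  by rewrite /c index_uniq ?fset_uniq // valK.
have c0 := indep c; move/eqP: x0; apply; apply/rowP => i; rewrite mxE -cT_.
apply: c0; last exact: mem_nth.
rewrite (big_nth 0%R) big_mkord -[RHS]xM mulmx_sum_row.
by apply: eq_bigr => j _; rewrite cT_ rowK.
Qed.

Lemma count_mass E m (V : 'M[F]_(m, n)) :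
  count (fun u => (r u <= V)%MS) E =
    mass (w := fun x => count (fun u => r u == x) E) V.
Proof. exact: (count_fibers r (fun x => (x <= V)%MS)). Qed.

Lemma count_class E x : [set` E] `<=` B -> x != 0%R ->
  count (fun u => class u == proj_class x) E =
    \sum_(y in proj_class x) count (fun u => r u == y) E.
Proof.
move=> EB x0; rewrite -(count_fibers r (mem (proj_class x))).
by apply: eq_in_count => u /EB/red_neq0 u0; rewrite /= proj_class_eq.
Qed.

Lemma count_red0 E : [set` E] `<=` B ->
  count (fun u => r u == 0 :> 'rV[F]_n)%R E = 0.
Proof.
move=> EB; apply/eqP; rewrite -leqn0 leqNgt -has_count.
by apply/hasPn => u /EB/red_neq0.
Qed.

(** A subspace of dimension at most l - 1 holds at most A (q^(l-1) - 1) / (q - 1) = k - 1 elements,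
    so the reductions of any k elements span dimension at least l. *)
Lemma kl_orthogonal_of_const k l A E : [set` E] `<=` B -> 1 < l -> 0 < k ->
  (k - 1) * (q - 1) = A * (q ^ (l - 1) - 1) ->
  {in proj_space F n, forall p, count (fun u => class u == p) E = A} ->
  kl_orthogonal nu q k l [set` E].
Proof.
move=> EB l1 k0 kA cA; split=> [u /EB/sphere_neq0//|E' E'E cE'].
have E'E' : (E' `<=` E)%fset by apply/fsubsetP => u /E'E.
have E'B := sub_sphere E'E' EB.
have q1 : 1 < q := card_finNzRing_gt1 F.
pose M := (\matrix_(i < #|` E'|) r (nth 0 (enum_fset E') i))%R.
have lM : l <= \rank M.
  rewrite leqNgt; apply/negP => Ml.
  have : k <= count (fun u => (r u <= M)%MS) E.
    apply: leq_trans (count_subfset _ E'E'); rewrite -cE' -size_filter.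
    rewrite (_ : filter _ _ = E') //; apply/all_filterP/allP => u uE /=.
    have iu : index u (enum_fset E') < #|` E'| by rewrite index_mem.
    have -> : r u = row (Ordinal iu) M by rewrite rowK /= nth_index.
    exact: row_sub.
  rewrite leqNgt => /negP; apply.
  have : count (fun u => (r u <= M)%MS) E * (q - 1) <= (k - 1) * (q - 1).
    rewrite count_mass (mass_const (count_red0 EB) (A := A)) => [|x x0].
      rewrite kA leq_mul2l; apply/orP; right.
      by apply: leq_sub2r; rewrite leq_exp2l //; lia.
    by rewrite -count_class // cA // mem_proj_space.
  by rewrite leq_pmul2r ?subn_gt0 //; lia.
(* [maxrankfun M] selects rows of M forming a basis of its row space; the first l of them are
   kept. *)
pose g (i : 'I_l) := maxrankfun M (widen_ord lM i).
have g_inj : injective g.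
  by move=> i j /maxrankfun_inj/(congr1 val)/= ij; apply: val_inj.
pose t i := nth 0%R (enum_fset E') (g i).
have t_inj : injective t.
  move=> i j /eqP; rewrite nth_uniq ?fset_uniq // => /eqP ij.
  exact/g_inj/val_inj.
exists [fset t i | i in enum 'I_l]%fset.
have TE : ([fset t i | i in enum 'I_l] `<=` E')%fset.
  by apply/fsubsetP => _ /imfsetP[i _ ->]; apply: mem_nth.
split=> //.
  rewrite card_imfset //= undup_id ?enum_uniq //.
  by rewrite size_enum_ord.
rewrite (orthogonal_redP hnu hred); last exact: sub_sphere TE E'B.
move=> c; rewrite big_imfset /=; last by move=> i j _ _; apply: t_inj.
rewrite undup_id ?enum_uniq // big_enum /= => c0.
pose N := rowsub (maxrankfun M) M.
pose x := (\row_(i < l) c (t i))%R.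
(* The factor [rowsub (widen_ord lM) 1%:M] pads x with zeros, turning a relation between the l
   chosen rows into one on the free family N. *)
have : (x *m rowsub (widen_ord lM) 1%:M *m N == 0)%R.
  rewrite -mulmxA -rowsubE mulmx_sum_row -[X in _ == X]c0; apply/eqP.
  by apply: eq_bigr => i _; rewrite mxE; congr (_ *: _)%R; apply/rowP => j;
    rewrite !mxE.
rewrite mulmx_free_eq0 ?maxrowsub_free // => /eqP x0.
move=> _ /imfsetP[i _ ->].
have := congr1 (fun X : 'rV[F]_(\rank M) => X 0%R (widen_ord lM i)) x0.
rewrite !mxE (bigD1 i) //= !mxE eqxx mulr1 big1 ?addr0 // => j ji.
by rewrite !mxE -val_eqE /= val_eqE (negPf ji) mulr0.
Qed.

Lemma size_fibers E : [set` E] `<=` B ->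
  #|` E| = \sum_(p in proj_space F n) count (fun u => class u == p) E.
Proof.
move=> EB; rewrite -(count_fibers (fun u => class u) (mem (proj_space F n))).
apply/esym/eqP; rewrite -all_count; apply/allP => u /EB/red_neq0 u0.
exact: mem_proj_space.
Qed.

(** The subset-sum bounds apply to the fiber sizes with d = l - 1. *)
Lemma kl_weakly_extremal k l A E : [set` E] `<=` B -> 1 < l -> l <= k ->
  l - 1 <= #|proj_space F n| ->
  (1 < l - 1 -> l - 1 < #|proj_space F n|) -> k - 1 = A * (l - 1) ->
  kl_weakly_orthogonal nu q k l [set` E] ->
  #|` E| <= #|proj_space F n| * A /\
  (#|` E| = #|proj_space F n| * A ->
   {in proj_space F n, forall p, count (fun u => class u == p) E = A}).
Proof.
move=> EB l1 lk lP lP' kA kl.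
have bound (X : {set {set 'rV[F]_n}}) : X \subset proj_space F n ->
    #|X| = l - 1 ->
    \sum_(p in X) count (fun u => class u == p) E <= A * (l - 1).
  move=> _ cX; rewrite -(count_fibers (fun u => class u) (mem X)) -kA.
  have Xl : #|X| < l by rewrite cX; lia.
  by have := kl_weakly_count EB kl Xl; rewrite /=; lia.
have d0 : 0 < l - 1 by lia.
rewrite size_fibers // mulnC; split=> [|EA p pP].
  by have := sum_subset_le d0 bound (subxx _) (esym (subnKC lP)); rewrite subnKC.
exact: (sum_subset_eq d0 bound).
Qed.

(** The mass bounds apply to the multiplicities of the reductions with d = l - 1; multiplying by q -
    1 turns the number of projective points into q^n - 1. *)
Lemma kl_orthogonal_extremal k l A E : [set` E] `<=` B -> 1 < l -> l <= k ->
  l - 1 <= n -> (1 < l - 1 -> l - 1 < n) ->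
  (k - 1) * (q - 1) = A * (q ^ (l - 1) - 1) ->
  kl_orthogonal nu q k l [set` E] ->
  #|` E| <= #|proj_space F n| * A /\
  (#|` E| = #|proj_space F n| * A ->
   {in proj_space F n, forall p, count (fun u => class u == p) E = A}).
Proof.
move=> EB l1 lk ln ln' kA kl.
have q1 : 0 < q - 1 by rewrite subn_gt0 card_finNzRing_gt1.
pose w (x : 'rV[F]_n) := count (fun u => r u == x) E.
have w0 : w 0%R = 0 := count_red0 EB.
have bound (V : 'M[F]_n) : \rank V = l - 1 ->
    mass (w := w) V * (q - 1) <= A * (q ^ (l - 1) - 1).
  move=> rV; rewrite -count_mass -kA leq_mul2r; apply/orP; right.
  have Vl : \rank V < l by rewrite rV; lia.
  by have := kl_orthogonal_count EB kl Vl; lia.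
have d0 : 0 < l - 1 by lia.
have sizeE : #|` E| = mass (w := w) (1%:M : 'M_n).
  rewrite -count_mass; apply/esym/eqP; rewrite -all_count; apply/allP => u _.
  exact: submx1.
have cardP : #|proj_space F n| * A * (q - 1) = A * (q ^ n - 1).
  by rewrite -card_proj_space; lia.
split=> [|EA p /proj_spaceP[x x0 ->]].
  rewrite -(leq_pmul2r q1) cardP sizeE -{4}(subnKC ln).
  by apply: mass_le => //; rewrite mxrank1 subnKC.
rewrite count_class //; apply: (mass_class_eq w0 d0 ln ln' bound) => //.
by rewrite -sizeE EA.
Qed.

(** * Infinite fibers and sets of maximal size *)

Lemma exists_val_gt0 : exists2 y, y != 0%R & (0 < nu y)%R.
Proof.
have [x x0 nx] := dval_nontrivial hnu.
have [xp|xn] := Num.Theory.ltrP 0%R (nu x); first by exists x.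
exists x^-1%R; first by rewrite invr_eq0.
have x0' : (x^-1 != 0)%R by rewrite invr_eq0.
have := dvalM hnu x0 x0'; rewrite divff // (dval1 hnu).
by move: nx xn; lia.
Qed.

Lemma dvalX y i : y != 0%R -> nu (y ^+ i)%R = (nu y *+ i)%R.
Proof.
move=> y0; elim: i => [|i IHi]; first by rewrite expr0 mulr0n (dval1 hnu).
by rewrite exprS (dvalM hnu) ?expf_neq0 // IHi mulrS.
Qed.

(** A lift of a representative x is shifted in every coordinate by y^(i+1) with [nu y] positive. The
    exponent i+1 keeps the shift in the maximal ideal, and the valuations of the shifts tell the
    vectors apart. *)
Lemma fiber_injection p : 0 < n -> p \in proj_space F n ->
  exists2 f : nat -> 'rV[K]_n, injective f &
    forall i, sphere_fiber nu red p (f i).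
Proof.
move=> n0 /proj_spaceP[x x0 ->]; have [y y0 ny] := exists_val_gt0.
have nX i : (0 < nu (y ^+ i.+1))%R.
  by rewrite dvalX // Num.Theory.pmulrn_lgt0.
have [lift liftP] : exists lift : F -> K, forall a,
    lift a \in valuation_ring nu /\ red (lift a) = a.
  exists (fun a => s2val (cid2 (residue_surj hred a))) => a.
  by case: cid2.
have XO i : (y ^+ i.+1)%R \in valuation_ring nu.
  by rewrite inE Order.POrderTheory.ltW ?nX ?orbT.
have redX i : red (y ^+ i.+1)%R = 0%R.
  apply/eqP; rewrite (residue_ker hred) ?XO //.
  by rewrite inE nX orbT.
pose f i : 'rV[K]_n := (\row_j (lift (x 0 j) + y ^+ i.+1))%R.
have rf i : r (f i) = x.
  apply/rowP => j; rewrite !mxE (residueD hred) ?XO //; last first.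
    by case: (liftP (x 0%R j)).
  by rewrite redX addr0; case: (liftP (x 0%R j)).
exists f => [i j /rowP/(_ (Ordinal n0))|i].
  rewrite !mxE => /addrI/(congr1 nu); rewrite !dvalX //.
  have ny0 : (nu y != 0)%R by lia.
  by move=> /(Num.Theory.mulrIn ny0)[].
split; last by rewrite rf.
apply/(vnorm_sphereP hred); split; last by rewrite rf.
by move=> j; rewrite mxE val_ringD ?XO //; case: (liftP (x 0%R j)).
Qed.

Lemma fiber_fset E p : [set` E] `<=` B ->
  [set` E] `&` sphere_fiber nu red p =
    [set` [fset u in E | class u == p]%fset].
Proof.
move=> EB; apply/seteqP; split=> u /=; rewrite !inE /=.
  by move=> [uE [_ /eqP ->]]; rewrite uE.
by move=> /andP[uE /eqP up]; split=> //; split=> //; apply: EB.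
Qed.

Lemma card_fiberP E p A : [set` E] `<=` B ->
  [set` E] `&` sphere_fiber nu red p #= `I_A <->
  count (fun u => class u == p) E = A.
Proof.
move=> EB; rewrite fiber_fset //.
suff <- : #|` [fset u in E | class u == p]%fset| =
          count (fun u => class u == p) E.
  by split=> /card_eq_fsetP.
rewrite -size_filter; apply/perm_size/uniq_perm; rewrite ?fset_uniq //.
  by rewrite filter_uniq // fset_uniq.
by move=> u; rewrite mem_filter !inE /= andbC.
Qed.

Lemma fibers_finite S A : S `<=` B ->
  (forall p, p \in proj_space F n -> S `&` sphere_fiber nu red p #= `I_A) ->
  finite_set S.
Proof.
move=> SB SA; suff -> : S =
    \bigcup_(p in [set` proj_space F n]) (S `&` sphere_fiber nu red p).
  by apply: bigcup_finite => // p /SA Sp; apply/finite_setP; exists A.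
apply/seteqP; split=> [u Su|u [p _ []]//].
have Bu := SB u Su; exists (class u); first by apply/mem_proj_space/red_neq0.
by split.
Qed.

(** The common frame of both characterisations: it passes from finite sets to arbitrary ones and
    shows that the bound is attained. *)
Lemma extremal_sets (Q : set 'rV[K]_n -> Prop) A : 0 < n ->
  (forall S S', S' `<=` S -> Q S -> Q S') ->
  (forall E, [set` E] `<=` B -> Q [set` E] ->
     #|` E| <= #|proj_space F n| * A /\
     (#|` E| = #|proj_space F n| * A ->
      {in proj_space F n, forall p, count (fun u => class u == p) E = A})) ->
  (forall E, [set` E] `<=` B ->
     {in proj_space F n, forall p, count (fun u => class u == p) E = A} ->
     Q [set` E]) ->
  exists D : nat,
    is_max_size (fun S => S `<=` B /\ Q S) D /\
    forall S, S `<=` B ->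
      (Q S /\ S #= `I_D <->
       forall p, p \in proj_space F n ->
         S `&` sphere_fiber nu red p #= `I_A).
Proof.
move=> n0 Qsub Qle Qconst; pose D := #|proj_space F n| * A; exists D.
have fin S : S `<=` B -> Q S -> exists2 E, S = [set` E] & #|` E| <= D.
  (* An infinite set would have a finite subset with more than D elements, which still satisfies
     Q. *)
  move=> SB QS; have /finite_fsetP[E SE] : finite_set S.
    apply: contrapT => /(infinite_set_fset D.+1)[E ES DE].
    have [] := Qle E (subset_trans ES SB) (Qsub _ _ ES QS).
    by rewrite leqNgt DE.
  by exists E => //; rewrite SE in SB QS; case: (Qle E SB QS).
have char S : S `<=` B ->
    (Q S /\ S #= `I_D <->
     forall p, p \in proj_space F n -> S `&` sphere_fiber nu red p #= `I_A).
  move=> SB; split=> [[QS SD] p pP|SA].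
    have [E SE _] := fin S SB QS; rewrite SE in SB QS SD *.
    apply/card_fiberP => //; apply: (Qle E SB QS).2 => //.
    exact/card_eq_fsetP.
  have /finite_fsetP[E SE] := fibers_finite SB SA; rewrite SE in SB SA *.
  have EA : {in proj_space F n, forall p, count (fun u => class u == p) E = A}.
    by move=> p /SA/(card_fiberP _ _ SB).
  split; first exact: Qconst.
  by apply/card_eq_fsetP; rewrite size_fibers // (eq_bigr _ EA) sum_nat_const.
split=> //; split; last first.
  move=> S [SB QS]; have [E -> ED] := fin S SB QS.
  have /card_eqPle[ES _] : [set` E] #= `I_#|` E| by apply/card_eq_fsetP.
  by apply: card_le_trans ES _; rewrite card_le_II.
have [f fP] : exists f : {set 'rV[F]_n} -> nat -> 'rV[K]_n, forall p,
    p \in proj_space F n ->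
    injective (f p) /\ forall i, sphere_fiber nu red p (f p i).
  have h p : exists g : nat -> 'rV[K]_n, p \in proj_space F n ->
      injective g /\ forall i, sphere_fiber nu red p (g i).
    have [pP|_] := boolP (p \in proj_space F n); last by exists (fun=> 0%R).
    by have [g ginj gp] := fiber_injection n0 pP; exists g.
  by exists (fun p => projT1 (cid (h p))) => p pP; case: cid => g /=; apply.
(* Choosing A vectors in every fiber attains the bound. *)
pose S := \bigcup_(p in [set` proj_space F n]) (f p @` `I_A).
have SB : S `<=` B by move=> _ [p pP [i _ <-]]; have [_ /(_ i)[]] := fP p pP.
exists S; suff [QS SD] : Q S /\ S #= `I_D by [].
apply/char => // p pP; have [finj fp] := fP p pP.
have -> : S `&` sphere_fiber nu red p = f p @` `I_A.
  apply/seteqP; split=> [_ [[p' pP' [i iA <-]] [_]]|_ [i iA <-]]; last first.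
    by split=> //; exists p => //; exists i.
  have [_ /(_ i)[_ ->]] := fP p' pP' => ->.
  by exists i.
exact: inj_card_eq (in2W finj).
Qed.

End Glue.

(** The bounds on l exclude degenerate cases: if l - 1 = n >= 2, no l vectors are orthogonal, the
    condition only says that the set has fewer than k elements, and the fibers of a largest set are
    not determined. The same happens for weak orthogonality when l - 1 is the number of projective
    points and is at least 2. The [maxn 2] retains l = 2 with a single projective point. *)
Theorem theorem1p6 (K : fieldType) (nu : K -> int) (F : finFieldType)
    (red : K -> F) (n k l : nat)
    (hnu : discrete_valuation nu) (hred : residue_map nu red)
    (hn : 0 < n) (hl : 2 <= l) (hlk : l <= k) :
  let q := #|F| in
  let B : set 'rV[K]_n := @unit_sphere K nu q n in
  (l <= maxn 2 #|proj_space F n| -> l - 1 %| k - 1 ->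
    exists Delta : nat,
      is_max_size (fun S => S `<=` B /\ kl_weakly_orthogonal nu q k l S) Delta /\
      forall A : set 'rV[K]_n, A `<=` B ->
        (kl_weakly_orthogonal nu q k l A /\ A #= `I_Delta <->
         forall p, p \in proj_space F n ->
           A `&` sphere_fiber nu red p #= `I_((k - 1) %/ (l - 1))))
  /\
  (l <= maxn 2 n -> (q ^ (l - 1) - 1) %/ (q - 1) %| k - 1 ->
    exists Theta : nat,
      is_max_size (fun S => S `<=` B /\ kl_orthogonal nu q k l S) Theta /\
      forall A : set 'rV[K]_n, A `<=` B ->
        (kl_orthogonal nu q k l A /\ A #= `I_Theta <->
         forall p, p \in proj_space F n ->
           A `&` sphere_fiber nu red p
             #= `I_(((k - 1) * (q - 1)) %/ (q ^ (l - 1) - 1)))).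
Proof.
move=> q B; have q1 : 1 < q := card_finNzRing_gt1 F.
have k0 : 0 < k by lia.
have P0 : 0 < #|proj_space F n|.
  have := card_proj_space (F := F) (n := n); rewrite -/q.
  have : 1 < q ^ n by rewrite -(expn0 q) ltn_exp2l.
  by case: #|proj_space F n| => //; lia.
split=> [lP dvd_k|ln dvd_k].
  apply: (extremal_sets hnu hred hn) => [S S' S'S [S0 Skl]|E EB|E EB EA].
  - by split=> [u /S'S/S0//|E ES]; apply: Skl; apply: subset_trans ES S'S.
  - by apply: (kl_weakly_extremal hnu hred EB hl hlk); rewrite ?divnK //; lia.
  - by apply: (kl_weakly_of_const hnu hred EB hl k0 _ EA); rewrite divnK.
have q1d : q - 1 %| q ^ (l - 1) - 1.
  by have := dvdn_pred_predX q (l - 1); rewrite !subn1.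
(* Multiplying the divisibility hypothesis by q - 1 shows that q^(l-1) - 1 divides (k - 1)(q - 1),
   so the quotient defining the fiber size is exact. *)
have kA : (k - 1) * (q - 1) =
    (k - 1) * (q - 1) %/ (q ^ (l - 1) - 1) * (q ^ (l - 1) - 1).
  by rewrite divnK // -[X in X %| _](divnK q1d) dvdn_pmul2r //; lia.
apply: (extremal_sets hnu hred hn) => [S S' S'S [S0 Skl]|E EB|E EB EA].
- by split=> [u /S'S/S0//|E ES]; apply: Skl; apply: subset_trans ES S'S.
- by apply: (kl_orthogonal_extremal hnu hred EB hl hlk _ _ kA); lia.
- exact: (kl_orthogonal_of_const hnu hred EB hl k0 kA EA).
Qed.
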